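(* Let $G$ be an oriented hypergraph with vertices $v_1,\dots,v_n$. Then $\lambda_1(L(G))\le\max_i\{d_i+\mathrm{NumAdj}(v_i)\}$.
   Context: An oriented hypergraph $G=(H,\sigma)$ consists of a finite hypergraph $H=(V,E,\mathcal{I})$ with vertex set $V=\{v_1,\dots,v_n\}$, a finite set $E$ of edges, each edge a (possibly empty) subset of $V$, and incidence set $\mathcal{I}$, together with an incidence orientation $\sigma:\mathcal{I}\to\{+1,-1\}$. Throughout, hypergraphs are simple: $(v,e)\in\mathcal{I}$ if and only if $v\in e$, each such pair occurring once. The degree $d_i$ of $v_i$ is the number of incidences containing $v_i$. The set of adjacencies is $\mathcal{A}=\{(e,\{v_i,v_j\}): e\in E,\ v_i\neq v_j,\ v_i,v_j\in e\}$, and $\mathrm{NumAdj}(v)$ is the number of adjacencies containing $v$. For distinct $v_i,v_j\in e$, $\mathrm{sgn}_e(v_i,v_j)=-\sigma(v_i,e)\sigma(v_j,e)$. The adjacency matrix $A(G)=(a_{ij})$ has $a_{ij}=\sum_{e\in E:\, v_i,v_j\in e}\mathrm{sgn}_e(v_i,v_j)$ for $i\neq j$ and $a_{ii}=0$; $D(G)=\mathrm{diag}(d_1,\dots,d_n)$; the Laplacian is $L(G)=D(G)-A(G)$. $\lambda_1(M)$ denotes the largest eigenvalue of a real symmetric matrix $M$. *)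

(* Defs.v *)
From HB Require Import structures.
From mathcomp Require Import all_boot all_order all_algebra.
From mathcomp Require Import complex polyrcf.
From mathcomp Require Import boolp classical_sets reals.
Set Implicit Arguments.
Unset Strict Implicit.
Unset Printing Implicit Defensive.
Import Order.TTheory GRing.Theory Num.Theory.
Local Open Scope ring_scope.

(* Simple hypergraphs on the vertices v_1, ..., v_n, represented by 'I_n. *)
Record hypergraph (n : nat) := Hypergraph { edges : {set {set 'I_n}} }.

Definition incidences (n : nat) (H : hypergraph n) :
    {set 'I_n * {set 'I_n}} :=
  [set p | (p.2 \in edges H) && (p.1 \in p.2)].

(* The orientation is a total function; its values off the incidence set are
   unconstrained, and no definition below looks at them. *)
Record oriented_hypergraph (n : nat) := OrientedHypergraph {
  underlying :> hypergraph n;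
  orientation : 'I_n -> {set 'I_n} -> int;
  orientation_sign : forall (v : 'I_n) (e : {set 'I_n}),
    (v, e) \in incidences underlying ->
    orientation v e = 1 \/ orientation v e = -1
}.

Definition degree (n : nat) (G : oriented_hypergraph n) (v : 'I_n) : nat :=
  #|[set p in incidences G | p.1 == v]|.

Definition adjacencies (n : nat) (G : oriented_hypergraph n) :
    {set {set 'I_n} * {set 'I_n}} :=
  [set a | (a.1 \in edges G) &&
     [exists u, exists w,
        [&& u != w, u \in a.1, w \in a.1 & a.2 == [set u; w]%SET]]].

Definition num_adj (n : nat) (G : oriented_hypergraph n) (v : 'I_n) : nat :=
  #|[set a in adjacencies G | v \in a.2]|.

Definition edge_sgn (n : nat) (G : oriented_hypergraph n) (e : {set 'I_n})
    (v w : 'I_n) : int :=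
  - (orientation G v e * orientation G w e).

Definition adjacency_mx (R : realType) (n : nat) (G : oriented_hypergraph n) :
    'M[R]_n :=
  \matrix_(i, j)
    if i == j then 0
    else \sum_(e in edges G | (i \in e) && (j \in e)) (edge_sgn G e i j)%:~R.

Definition degree_mx (R : realType) (n : nat) (G : oriented_hypergraph n) :
    'M[R]_n :=
  diag_mx (\row_i (degree G i)%:R).

Definition laplacian_mx (R : realType) (n : nat) (G : oriented_hypergraph n) :
    'M[R]_n :=
  degree_mx R G - adjacency_mx R G.

(* The supremum of the eigenvalues: for a symmetric matrix of positive size it
   is attained, so it is the largest eigenvalue (lemma lambda1P below). *)
Definition lambda1 (R : realType) (n : nat) (M : 'M[R]_n) : R :=
  sup [set a : R | eigenvalue M a]%classic.

Lemma laplacian_mx_sym (R : realType) (n : nat) (G : oriented_hypergraph n) :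
  (laplacian_mx R G)^T = laplacian_mx R G.
Proof.
apply/matrixP => i j; rewrite !mxE eq_sym.
case: eqVneq => [->|_] //; rewrite !mulr0n; congr (_ - _).
apply: eq_big => [e|e _]; first by congr (_ && _); rewrite andbC.
by rewrite /edge_sgn mulrC.
Qed.

Lemma symmetric_eigenvalue (R : realType) (n : nat) (M : 'M[R]_n) :
  (0 < n)%N -> M^T = M -> exists a : R, eigenvalue M a.
Proof.
move=> n0 Msym; pose f := real_complex R.
have [a /eigenvalueP [v va v0]] := eigenvalue_closed (map_mx f M) n0.
pose w := map_mx Num.conj v.
have wa : w *m map_mx f M = Num.conj a *: w.
  have := congr1 (map_mx Num.conj) va; rewrite map_mxM map_mxZ.
  suff -> : map_mx Num.conj (map_mx f M) = map_mx f M by [].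
  by apply/matrixP => i j; rewrite !mxE; exact: conjc_real.
have : a *: (v *m w^T) = Num.conj a *: (v *m w^T).
  rewrite scalemxAl -va -mulmxA -[X in _ *m (X *m _)]trmxK -trmx_mul.
  suff -> : (map_mx f M)^T = map_mx f M by rewrite wa linearZ /= scalemxAr.
  by rewrite -[in RHS]Msym; apply/matrixP => i j; rewrite !mxE.
move=> /matrixP /(_ ord0 ord0); rewrite !mxE => /mulIf aE.
have {}aE : a = Num.conj a.
  apply: aE; apply: contra v0 => /eqP s0; apply/eqP/rowP => i.
  apply/eqP; rewrite mxE -normr_eq0 -sqrf_eq0 normCK; apply/eqP.
  have := s0; under eq_bigr => k _ do rewrite !mxE -normCK.
  move=> /psumr_eq0P -/(_ (fun k _ => exprn_ge0 2 (normr_ge0 _))) /(_ i isT).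
  by rewrite normCK.
have aR : a = f (complex.Re a).
  by move: aE; case: (a) => x y [] /eqP; rewrite -addr_eq0 -mulr2n mulrn_eq0
    /= => /eqP ->.
exists (complex.Re a); rewrite -(eigenvalue_map f).
by apply/eigenvalueP; exists v => //; rewrite va [in LHS]aR.
Qed.

Lemma lambda1P (R : realType) (n : nat) (M : 'M[R]_n) :
  (0 < n)%N -> M^T = M ->
  eigenvalue M (lambda1 M) /\ forall a, eigenvalue M a -> a <= lambda1 M.
Proof.
move=> n0 /(symmetric_eigenvalue n0) [a0 ea0].
have p0 : char_poly M != 0 by exact/monic_neq0/char_poly_monic.
have sE a : eigenvalue M a = (a \in rootsR (char_poly M)).
  by rewrite eigenvalue_root_char -(roots_on_rootsR p0) in_itv.
have [m [ms mub]] : exists m : R, m \in rootsR (char_poly M) /\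
    forall a, a \in rootsR (char_poly M) -> a <= m.
  have : a0 \in rootsR (char_poly M) by rewrite -sE.
  elim: (rootsR _) a0 {ea0} => [//|x [|y s] IH] a0 _.
    by exists x; rewrite inE; split=> // a; rewrite inE => /eqP ->.
  have [m [ms mub]] := IH y (mem_head _ _).
  exists (Num.max x m); split.
    by case: leP; rewrite !(inE, eqxx) // => _; rewrite -in_cons ms orbT.
  move=> a; rewrite inE le_max => /orP[/eqP ->|/mub ->]; first by rewrite lexx.
  by rewrite orbT.
have ubm : ubound [set a : R | eigenvalue M a]%classic m.
  by move=> a /=; rewrite sE; exact: mub.
suff -> : lambda1 M = m by split=> [|a]; rewrite sE //; exact: mub.
apply/eqP; rewrite eq_le; apply/andP; split.
  by apply: ge_sup => //; exists a0.
by apply: ub_le_sup; [exists m | rewrite /= sE].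
Qed.

(* Main.v *)
(* Gershgorin's theorem for the columns of the Laplacian: column k has diagonal
   entry [degree G k], and the absolute values of its other entries sum to at
   most the number of pairs (i, e) with i != k and i, k in e.  These pairs
   inject into the adjacencies containing k by (i, e) |-> (e, {i, k}). *)
Require Import Defs.
From mathcomp Require Import all_boot all_order all_algebra.
From mathcomp Require Import reals.
Import Order.TTheory GRing.Theory Num.Theory.
Local Open Scope ring_scope.

(** An eigenvector is a row [v] with [v *m M = a *: v], hence a bound by column sums. Take [k]
    maximizing [|v 0 k|], read this equation at coordinate [k], and cancel [|v 0 k|], which is
    positive as [v] is nonzero. *)
Lemma gershgorin_col (R : realFieldType) (n : nat) (M : 'M[R]_n) (a : R) :
  eigenvalue M a ->
  exists k, `|a - M k k| <= \sum_(i | i != k) `|M i k|.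
Proof.
case/eigenvalueP=> v va /rV0Pn [k0 vk0].
have [k _ kmax] := Order.TotalTheory.arg_maxP
  (fun i => `|v 0 i|) (isT : xpredT k0).
exists k.
have vk_gt0 : 0 < `|v 0 k|.
  by apply: lt_le_trans (kmax k0 isT); rewrite normr_gt0.
rewrite -(ler_pM2r vk_gt0) -normrM mulr_suml.
(* The diagonal term of coordinate [k] is moved to the side of the eigenvalue. *)
have -> : (a - M k k) * v 0 k = \sum_(i | i != k) v 0 i * M i k.
  have /rowP/(_ k) := va; rewrite !mxE (bigD1 k) //= => eq_k.
  by apply/eqP; rewrite mulrBl -eq_k subr_eq addrC [M k k * _]mulrC.
apply: le_trans (ler_norm_sum _ _ _) _.
apply: ler_sum => i _.
by rewrite normrM mulrC; apply: ler_wpM2l => //; apply: kmax.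
Qed.

(** Each common edge contributes a term of absolute value 1, so the triangle inequality counts these
    edges; a diagonal entry is 0. *)
Lemma adjacency_mx_norm_le (R : realType) (n : nat) (G : oriented_hypergraph n)
    (i j : 'I_n) :
  `|adjacency_mx R G i j|
    <= #|[set e in edges G | (i \in e) && (j \in e)]|%:R.
Proof.
rewrite mxE; case: eqP => [_|_]; first by rewrite normr0 ler0n.
apply: le_trans (ler_norm_sum _ _ _) _.
rewrite -sum1_card natr_sum.
under [leRHS]eq_bigl do rewrite inE.
apply: ler_sum => e /and3P[eG ie je].
have sgn u : u \in e -> `|(orientation G u e)%:~R| = 1 :> R.
  move=> ue; have uG : (u, e) \in incidences G by rewrite inE /= eG ue.
  by have [->|->] := orientation_sign uG; rewrite ?mulrN1z ?normrN normr1.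
by rewrite /edge_sgn mulrNz normrN intrM normrM !sgn ?mulr1.
Qed.

Lemma sum_common_edges_le_num_adj (n : nat) (G : oriented_hypergraph n)
    (k : 'I_n) :
  (\sum_(i | i != k) #|[set e in edges G | (i \in e) && (k \in e)]|
    <= num_adj G k)%N.
Proof.
pose P := [set p : 'I_n * {set 'I_n} | (p.1 != k) &&
  [&& p.2 \in edges G, p.1 \in p.2 & k \in p.2]].
have -> : (\sum_(i | i != k) #|[set e in edges G | (i \in e) && (k \in e)]|
    = #|P|)%N.
  under eq_bigr do rewrite -sum1_card.
  rewrite pair_big_dep -sum1_card.
  by apply: eq_bigl => p; rewrite !inE.
pose f (p : 'I_n * {set 'I_n}) := (p.2, [set p.1; k]).
(* As [i != k], the vertex [i] is recovered from [{i, k}] as the element other than [k]. *)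
have finj : {in P &, injective f}.
  move=> [i e] [j e']; rewrite !inE /= => /andP[ik _] _ [-> eq_pair].
  congr (_, _); have : i \in [set j; k] by rewrite -eq_pair set21.
  by rewrite !inE (negPf ik) orbF => /eqP.
rewrite -(card_in_imset finj); apply: subset_leq_card.
apply/subsetP => _ /imsetP[[i e] + ->].
rewrite inE /= => /and4P[ik eG ie ke]; rewrite !inE /= eG eqxx orbT andbT /=.
by apply/existsP; exists i; apply/existsP; exists k; rewrite ik ie ke eqxx.
Qed.

Theorem theorem4p7 (R : realType) (n : nat) (hn : (0 < n)%N)
    (G : oriented_hypergraph n) :
  lambda1 (laplacian_mx R G)
    <= (\max_(i < n) (degree G i + num_adj G i))%N%:R.
Proof.
have [eig _] := lambda1P hn (laplacian_mx_sym R G).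
have [k] := gershgorin_col _ _ _ _ eig.
have -> : laplacian_mx R G k k = (degree G k)%:R.
  by rewrite !mxE eqxx mulr1n subr0.
(* Only the right end of the Gershgorin interval around [degree G k] is kept. *)
move=> /(le_trans (ler_norm _)); rewrite lerBlDl => /le_trans; apply.
apply: (@le_trans _ _ (degree G k + num_adj G k)%:R); last first.
  by rewrite ler_nat; exact: (leq_bigmax (F := fun i => degree G i + num_adj G i)%N).
rewrite natrD lerD2l.
apply: le_trans (_ : (\sum_(i | i != k)
    #|[set e in edges G | (i \in e) && (k \in e)]|)%:R <= _); last first.
  by rewrite ler_nat sum_common_edges_le_num_adj.
rewrite natr_sum; apply: ler_sum => i ik.
(* Off the diagonal, the Laplacian is the negated adjacency matrix. *)
apply: le_trans (adjacency_mx_norm_le R n G i k).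
by rewrite [laplacian_mx _ _ _ _]mxE [degree_mx _ _ _ _]mxE (negPf ik) mulr0n
  add0r mxE normrN.
Qed.
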